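(* Let $H$ be a Hilbert space, let $F:H\to(-\infty,+\infty]$ be proper and lower semicontinuous, and let $\widetilde F:H\to(-\infty,+\infty]$. Let $R,M>0$ and $\delta\ge 0$, and assume that $$\mathcal G_{R,M}(F,\widetilde F)\le \delta.$$ Let $x\in H$ satisfy $\|x\|\le R$, and assume that $F(x)\in[-M,M]$ and $\widetilde F(x)\in[-M,M]$. Then $$|F(x)-\widetilde F(x)|\le \delta.$$
   Context: For a functional $F:H\to(-\infty,+\infty]$, the vertical distance-to-epigraph map is, for $(x,t)\in H\times\mathbb{R}$, $$d_F^{\mathrm v}(x,t):=\inf_{s\in\mathbb{R},\,s\ge F(x)}|t-s|=(F(x)-t)_+\in[0,+\infty],\qquad (r)_+:=\max\{r,0\}.$$ For $R,M>0$ let $C_{R,M}:=\{(x,t)\in H\times\mathbb{R}:\ \|x\|\le R,\ |t|\le M\}$. The localized vertical epigraphic gauge is $$\mathcal G_{R,M}(F,\widetilde F):=\sup_{(x,t)\in C_{R,M}}\bigl|d_F^{\mathrm v}(x,t)-d_{\widetilde F}^{\mathrm v}(x,t)\bigr|\in[0,+\infty],$$ with the convention that the difference is $0$ where both distances equal $+\infty$ (and its absolute value is $+\infty$ where exactly one of them does). *)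

(* Defs.v *)
(* MathComp / MathComp-Analysis *)
From mathcomp Require Import all_boot all_order all_algebra.
From mathcomp Require Import all_classical all_reals all_analysis.

Set Implicit Arguments.
Unset Strict Implicit.
Unset Printing Implicit Defensive.

Import Order.TTheory GRing.Theory Num.Theory.
Import numFieldNormedType.Exports.

Local Open Scope classical_set_scope.
Local Open Scope ring_scope.
Local Open Scope ereal_scope.

(* The infimum over the empty set is +oo, so the value is +oo when F x = +oo. *)
Definition vert_dist (R : realType) (H : normedModType R) (F : H -> \bar R)
    (p : H * R) : \bar R :=
  ereal_inf [set (`|p.2 - s|%R)%:E | s in [set s : R | F p.1 <= s%:E]].

Definition cylinder (R : realType) (H : normedModType R) (rho M : R) :
    set (H * R) :=
  [set p | (`|p.1| <= rho)%R /\ (`|p.2| <= M)%R].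

(* The case split is needed because +oo - +oo = -oo in \bar R, whereas two
   infinite distances are to be at distance 0; if exactly one of a and b is
   +oo, then `|a - b| = +oo. *)
Definition abs_diff (R : realType) (a b : \bar R) : \bar R :=
  if (a == +oo) && (b == +oo) then 0 else `|a - b|.

Definition epi_gauge (R : realType) (H : normedModType R) (rho M : R)
    (F G : H -> \bar R) : \bar R :=
  ereal_sup [set abs_diff (vert_dist F p) (vert_dist G p)
            | p in cylinder rho M].

(* Main.v *)
Require Import Defs.
From mathcomp Require Import all_boot all_order all_algebra.
From mathcomp Require Import all_classical all_reals all_analysis.

(** At a height [t] lying below both graphs over [x], the vertical distances to
    the two epigraphs are the actual gaps [F x - t] and [Ft x - t]
    ([vert_dist_below]), without any truncation by the positive part; the
    height cancels in their difference, which is [F x - Ft x].  The lower of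
    the two values [F x] and [Ft x] is such a height, and it is in [- M, M]
    because both values are, so that this difference is one of those over which
    the gauge takes its supremum. *)

Import Order.TTheory GRing.Theory Num.Theory.
Import numFieldNormedType.Exports.

Local Open Scope classical_set_scope.
Local Open Scope ring_scope.

(** From a point below the graph, the nearest point of the epigraph on the
    vertical line through it is the graph point: the infimum is attained at
    [s = F y]. *)
Lemma vert_dist_below (R : realType) (H : normedModType R) (F : H -> \bar R)
    (y : H) (r t : R) :
  F y = r%:E -> t <= r -> vert_dist F (y, t) = (r - t)%:E.
Proof.
move=> Fy le_tr; rewrite /vert_dist /= Fy.
apply/eqP; rewrite eq_le; apply/andP; split.
  apply: ereal_inf_lbound; exists r => //=.
  by rewrite distrC ger0_norm ?subr_ge0.
apply: le_ereal_inf_tmp => _ [s /= le_rs <-]; rewrite !lee_fin in le_rs *.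
by rewrite distrC ger0_norm ?subr_ge0 ?(le_trans le_tr) // lerB.
Qed.

Arguments vert_dist_below {R H F y r t}.

Theorem theorem1 (R : realType)
  (H : completeNormedModType R) (dot : {dot H for idfun})
  (norm_dot : forall u : H, dot u u = `|u| ^+ 2)
  (F Ft : H -> \bar R)
  (F_gtNy : forall y : H, (-oo < F y)%E)
  (F_proper : exists y : H, (F y < +oo)%E)
  (F_lsc : lower_semicontinuous F)
  (Ft_gtNy : forall y : H, (-oo < Ft y)%E)
  (rho M delta : R) (rho_gt0 : 0 < rho) (M_gt0 : 0 < M)
  (delta_ge0 : 0 <= delta)
  (gauge_le : (epi_gauge rho M F Ft <= delta%:E)%E)
  (x : H) (x_le : `|x| <= rho)
  (Fx_itv : ((- M)%:E <= F x <= M%:E)%E)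
  (Ftx_itv : ((- M)%:E <= Ft x <= M%:E)%E) :
  (`|F x - Ft x| <= delta%:E)%E.
Proof.
case Fx: (F x) Fx_itv => [a| |]; rewrite ?leye_eq ?andbF // => /andP[].
rewrite !lee_fin => leNMa leaM.
case Ftx: (Ft x) Ftx_itv => [b| |]; rewrite ?leye_eq ?andbF // => /andP[].
rewrite !lee_fin => leNMb lebM; rewrite -lee_fin.
apply: (le_trans _ gauge_le); apply: ereal_sup_ubound.
exists (x, Num.min a b).
  by split=> //=; rewrite ler_norml le_min leNMa leNMb ge_min leaM.
rewrite (vert_dist_below Fx) ?ge_min ?lexx //.
rewrite (vert_dist_below Ftx) ?ge_min ?lexx ?orbT //.
by rewrite /abs_diff /= opprB addrA subrK.
Qed.
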